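(* There is an absolute constant $c>0$ such that the following holds. Let $G$ be a finite cyclic group of order $n\ge 2$ with generator $\gamma$, let $d:G\to G$ be the univariate Diffie-Hellman mapping $d(\gamma^a)=\gamma^{a^2}$, $a=0,\ldots,n-1$, and let $f$ be any cyclotomic mapping of index $\ell$ of $G$ (for any positive divisor $\ell$ of $n$). Then the number of $x\in G$ with $f(x)=d(x)$ is at most $c\,\ell\, n^{1/2}$. Moreover, if $n$ is prime, this number is at most $2\ell$.
   Context: For a positive divisor $\ell$ of $n$, let $C_{\ell,0}=\{\gamma^{j\ell}: j=0,1,\ldots,n/\ell-1\}$ and $C_{\ell,i}=\gamma^i C_{\ell,0}$ for $i=0,1,\ldots,\ell-1$. A cyclotomic mapping of index $\ell$ of $G$ is a map $f:G\to G$ for which there exist a positive integer $r$ and $a_0,\ldots,a_{\ell-1}\in G$ with $f(x)=a_i x^r$ whenever $x\in C_{\ell,i}$, $i=0,\ldots,\ell-1$. *)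

(* Defs.v *)
From HB Require Import structures.
From mathcomp Require Import all_boot all_order all_algebra all_fingroup all_solvable.

Set Implicit Arguments.
Unset Strict Implicit.
Unset Printing Implicit Defensive.

Import GroupScope.

(* [l] is meant to be a positive divisor of [#|G|] and [g] a generator of [G]. *)
Definition cyclotomic_coset0 (gT : finGroupType) (G : {group gT}) (g : gT)
    (l : nat) : {set gT} :=
  [set g ^+ (j * l)%N | j : 'I_(#|G| %/ l)].

Definition cyclotomic_coset (gT : finGroupType) (G : {group gT}) (g : gT)
    (l i : nat) : {set gT} :=
  g ^+ i *: cyclotomic_coset0 G g l.

(* The values of [f] outside [G] are unconstrained: [f] represents the map
   G -> G obtained by restriction, the cosets covering [G]. *)
Definition cyclotomic_mapping (gT : finGroupType) (G : {group gT}) (g : gT)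
    (l : nat) (f : gT -> gT) : Prop :=
  exists (r : nat) (a : 'I_l -> gT),
    [/\ (0 < r)%N,
        forall i : 'I_l, a i \in G
      & forall (i : 'I_l) (x : gT),
          x \in cyclotomic_coset G g l i -> f x = a i * x ^+ r].

(* When [g] generates [G] this determines [d] on [G]; the values outside [G]
   are unconstrained. *)
Definition diffie_hellman_mapping (gT : finGroupType) (G : {group gT}) (g : gT)
    (d : gT -> gT) : Prop :=
  forall a : nat, (a < #|G|)%N -> d (g ^+ a) = g ^+ (a ^ 2)%N.

(* Main.v *)
(* On the coset indexed by i, comparing exponents of g turns f x = d x into a
   monic quadratic congruence modulo n, so there are at most l times as many
   agreements as such a congruence can have roots.  For two roots x, y of
   X^2 - r X - b modulo p^k, p^k divides (y - x) (y - (r - x)); hence, x being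
   fixed, y is close p-adically to x or to r - x.  This gives at most
   2 p^((k-1)/2) roots for k odd and p^(k/2) roots for k even, that is at most
   p^(k/2) as soon as p >= 5.  By the Chinese remainder theorem only the primes
   2 and 3 contribute a constant factor to the bound sqrt n for a general n. *)

Require Import Defs.
From HB Require Import structures.
From mathcomp Require Import all_boot all_order all_algebra all_fingroup all_solvable.
From mathcomp Require Import reals ring zify.

Set Implicit Arguments.
Unset Strict Implicit.
Unset Printing Implicit Defensive.

Import Order.TTheory GRing.Theory Num.Theory.
Local Open Scope ring_scope.

(** * Quadratic congruences under coprime moduli *)

Definition quad_roots (n : nat) (r b : int) : {set 'I_n} :=
  [set x : 'I_n | (n%:Z %| (x : nat)%:Z ^+ 2 - r * (x : nat)%:Z - b)%Z].

Lemma dvdz_subn_eqn_mod (d x y : nat) :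
  (d%:Z %| x%:Z - y%:Z)%Z -> (x = y %[mod d])%N.
Proof. by rewrite -eqz_mod_dvd !modz_nat => /eqP[]. Qed.

Lemma dvdz_quad_modn (m x : nat) (r b : int) :
  (m%:Z %| x%:Z ^+ 2 - r * x%:Z - b)%Z ->
  (m%:Z %| (x %% m)%N%:Z ^+ 2 - r * (x %% m)%N%:Z - b)%Z.
Proof.
move=> H.
have -> : (x %% m)%N%:Z = x%:Z - m%:Z * (x %/ m)%N%:Z.
  by rewrite {2}(divn_eq x m) PoszD PoszM; ring.
set q := (x %/ m)%N%:Z.
have -> : (x%:Z - m%:Z * q) ^+ 2 - r * (x%:Z - m%:Z * q) - b =
  (x%:Z ^+ 2 - r * x%:Z - b) + m%:Z * (m%:Z * q ^+ 2 - 2 * x%:Z * q + r * q).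
  by ring.
by rewrite rpredD // dvdz_mulr.
Qed.

(** Reduction modulo [m1] and [m2] sends roots to roots and is injective by the Chinese remainder
    theorem; surjectivity is not at stake for an upper bound. *)
Lemma card_quad_rootsM (m1 m2 : nat) (r b : int) :
  (0 < m1)%N -> (0 < m2)%N -> coprime m1 m2 ->
  (#|quad_roots (m1 * m2) r b| <= #|quad_roots m1 r b| * #|quad_roots m2 r b|)%N.
Proof.
case: m1 m2 => [|m1] // [|m2] // _ _ co.
rewrite -cardsX.
pose h (x : 'I_(m1.+1 * m2.+1)) : 'I_m1.+1 * 'I_m2.+1 := (inord (x %% m1.+1), inord (x %% m2.+1)).
have h_inj : injective h.
  move=> x y [] /(congr1 val) /= e1 /(congr1 val) /= e2.
  move: e1 e2; rewrite !inordK ?ltn_mod // => e1 e2.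
  apply/val_inj => /=.
  rewrite -(modn_small (ltn_ord x)) -(modn_small (ltn_ord y)).
  by apply/eqP; rewrite chinese_remainder ?e1 ?e2 ?eqxx.
rewrite -(card_imset _ h_inj); apply/subset_leq_card/subsetP => _ /imsetP[x + ->].
rewrite !inE /= !inordK ?ltn_mod // => Hx.
by apply/andP; split; apply: dvdz_quad_modn; apply: (dvdz_trans _ Hx);
  rewrite dvdzE /=; [apply: dvdn_mulr | apply: dvdn_mull].
Qed.

(** * Prime power moduli *)

Lemma card_residue_class (n d : nat) (c : int) (A : {set 'I_n}) :
  (0 < n)%N -> (d %| n)%N -> (forall x, x \in A -> (d%:Z %| (x : nat)%:Z - c)%Z) ->
  (#|A| <= n %/ d)%N.
Proof.
move=> n_gt0 dn HA.
have d_gt0 : (0 < d)%N by apply: dvdn_gt0 dn.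
have [->|[y yA]] := set_0Vmem A; first by rewrite cards0.
have lt_div (x : 'I_n) : (x %/ d < n %/ d)%N by rewrite ltn_divLR // divnK.
pose h (x : 'I_n) : 'I_(n %/ d) := Ordinal (lt_div x).
(* Elements of one residue class modulo [d] share their remainder, so the quotient determines
   them. *)
have h_inj : {in A &, injective h}.
  move=> x z xA zA [] e; apply/val_inj => /=.
  rewrite (divn_eq x d) (divn_eq z d) e; congr addn.
  apply: dvdz_subn_eqn_mod.
  have -> : (x : nat)%:Z - (z : nat)%:Z = ((x : nat)%:Z - c) - ((z : nat)%:Z - c) by ring.
  by rewrite rpredB ?HA.
by rewrite -(card_in_imset h_inj) -[X in (_ <= X)%N]card_ord max_card.
Qed.

Lemma card_residue_class2 (n d : nat) (c1 c2 : int) (A : {set 'I_n}) :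
  (0 < n)%N -> (d %| n)%N ->
  (forall x, x \in A -> (d%:Z %| (x : nat)%:Z - c1)%Z || (d%:Z %| (x : nat)%:Z - c2)%Z) ->
  (#|A| <= 2 * (n %/ d))%N.
Proof.
move=> n_gt0 dn HA.
pose B := [set x : 'I_n | (d%:Z %| (x : nat)%:Z - c1)%Z].
rewrite -(cardsID B A) mul2n -addnn leq_add //.
  by apply: (@card_residue_class _ _ c1) => // x; rewrite !inE => /andP[].
apply: (@card_residue_class _ _ c2) => // x; rewrite !inE => /andP[nB /HA].
by rewrite (negPf nB).
Qed.

(** Let [p ^ c] be the gcd of [p ^ k] and [u]. If [c < a], the remaining factor [p ^ (k - c)]
    divides [v], and [k - c >= b]. *)
Lemma prime_power_dvdzM (p k a b : nat) (u v : int) :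
  prime p -> (a + b = k.+1)%N -> ((p ^ k)%N%:Z %| u * v)%Z ->
  ((p ^ a)%N%:Z %| u)%Z || ((p ^ b)%N%:Z %| v)%Z.
Proof.
move=> pp abk; rewrite !dvdzE abszM /=.
move: `|u|%N `|v|%N => {}u {}v uv.
have /dvdn_pfactor[//|c ck gE] : (gcdn (p ^ k) u %| p ^ k)%N by apply: dvdn_gcdl.
have [ac|ca] := leqP a c.
  by rewrite (dvdn_trans (dvdn_exp2l p ac)) // -gE dvdn_gcdr.
apply/orP; right.
have : (p ^ k %| p ^ c * v)%N by rewrite -gE muln_gcdl dvdn_gcd dvdn_mulr.
rewrite -(subnKC ck) expnD dvdn_pmul2l ?expn_gt0 ?prime_gt0 //.
by apply: dvdn_trans; apply: dvdn_exp2l; lia.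
Qed.

(** The product is the difference of the values of the quadratic at [y] and [x]. *)
Lemma quad_roots_dvdM (n : nat) (r b : int) (x y : 'I_n) :
  x \in quad_roots n r b -> y \in quad_roots n r b ->
  (n%:Z %| ((y : nat)%:Z - (x : nat)%:Z) * ((y : nat)%:Z - (r - (x : nat)%:Z)))%Z.
Proof.
rewrite !inE => Hx Hy; move: (rpredB Hy Hx); congr (_ %| _)%Z; ring.
Qed.

Lemma card_quad_roots_odd_power (p h : nat) (r b : int) : prime p ->
  (#|quad_roots (p ^ h.*2.+1) r b| <= 2 * p ^ h)%N.
Proof.
move=> pp; have p_gt0 := prime_gt0 pp.
have [->|[x xA]] := set_0Vmem (quad_roots (p ^ h.*2.+1) r b); first by rewrite cards0.
have e : (p ^ h.*2.+1 %/ p ^ h.+1 = p ^ h)%N.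
  by rewrite -expnB //; [congr expn; lia | lia].
(* The exponent [h.*2.+1] splits as [a = b = h.+1], giving two classes of [p ^ h] elements each. *)
rewrite -e; apply: (@card_residue_class2 _ _ (x : nat)%:Z (r - (x : nat)%:Z)).
- by rewrite expn_gt0 p_gt0.
- by apply: dvdn_exp2l; lia.
by move=> y yA; apply: (prime_power_dvdzM pp _ (quad_roots_dvdM xA yA)); lia.
Qed.

Lemma card_quad_roots_even_power (p h : nat) (r b : int) : prime p ->
  (#|quad_roots (p ^ h.*2) r b| <= p ^ h)%N.
Proof.
move=> pp; have p_gt0 := prime_gt0 pp.
have [->|[x xA]] := set_0Vmem (quad_roots (p ^ h.*2) r b); first by rewrite cards0.
have n_gt0 : (0 < p ^ h.*2)%N by rewrite expn_gt0 p_gt0.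
have split y : y \in quad_roots (p ^ h.*2) r b -> forall i j, (i + j = h.*2.+1)%N ->
    ((p ^ i)%N%:Z %| (y : nat)%:Z - (x : nat)%:Z)%Z
    || ((p ^ j)%N%:Z %| (y : nat)%:Z - (r - (x : nat)%:Z))%Z.
  by move=> yA i j ij; apply: (prime_power_dvdzM pp ij (quad_roots_dvdM xA yA)).
have sub : ((p ^ h)%N%:Z %| (p ^ h.+1)%N%:Z)%Z by rewrite dvdzE /= dvdn_exp2l.
have diffE (y : int) : r - (x : nat)%:Z - (x : nat)%:Z = (y - (x : nat)%:Z) - (y - (r - (x : nat)%:Z)).
  by ring.
(* If [x] and [r - x] agree modulo [p ^ h], all roots lie in a single class modulo [p ^ h].
   Otherwise no root is close to both, which improves the modulus to [p ^ h.+1]. *)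
have [dx|ndx] := boolP ((p ^ h)%N%:Z %| r - (x : nat)%:Z - (x : nat)%:Z)%Z.
  have e : (p ^ h.*2 %/ p ^ h = p ^ h)%N by rewrite -expnB //; [congr expn; lia | lia].
  rewrite -[X in (_ <= X)%N]e; apply: (@card_residue_class _ _ (x : nat)%:Z) => //.
    by apply: dvdn_exp2l; lia.
  move=> y yA; case/orP: (split y yA h h.+1 ltac:(lia)) => // /(dvdz_trans sub) hy.
  by rewrite (diffE y%:Z) in dx; rewrite -(subrK (y%:Z - (r - x%:Z)) (y%:Z - x%:Z)) rpredD.
(* [h = 0] is excluded, as 1 divides everything; from here on [h.+1] replaces [h]. Two classes of
   [p ^ h] elements suffice, since [2 <= p]. *)
case: h => [|h] in x xA n_gt0 split sub ndx diffE *; first by rewrite dvd1z in ndx.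
have e : (p ^ h.+1.*2 %/ p ^ h.+2 = p ^ h)%N by rewrite -expnB //; [congr expn; lia | lia].
apply: (@leq_trans (2 * p ^ h)%N); last by rewrite expnS leq_mul2r prime_gt1 // orbT.
rewrite -e; apply: (@card_residue_class2 _ _ (x : nat)%:Z (r - (x : nat)%:Z)) => //.
  by apply: dvdn_exp2l; lia.
move=> y yA; case/orP: (split y yA h.+2 h.+1 ltac:(lia)) => [->//|h1].
case/orP: (split y yA h.+1 h.+2 ltac:(lia)) => [h2|->]; last by rewrite orbT.
by case/negP: ndx; rewrite (diffE y%:Z) rpredB.
Qed.

Lemma card_quad_roots_prime_power (p k : nat) (r b : int) : prime p ->
  (#|quad_roots (p ^ k) r b| ^ 2 <= (if p <= 3 then 2 else 1) * p ^ k)%N.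
Proof.
move=> pp; have p_gt1 := prime_gt1 pp.
rewrite -(odd_double_half k); case: (odd k) => /=; move: k./2 => h.
  have H := card_quad_roots_odd_power h r b pp.
  rewrite add1n (leq_trans (n := (2 * p ^ h) ^ 2)) ?leq_sqr //.
  rewrite expnMn -expnM muln2 (expnS p) mulnA leq_mul2r; apply/orP; right.
  (* What remains is [4 <= 2 * p] for [p <= 3], and [4 <= p] otherwise. *)
  case: ifP => [_|]; lia.
have H := card_quad_roots_even_power h r b pp.
rewrite add0n (leq_trans (n := (p ^ h) ^ 2)) ?leq_sqr // -expnM muln2.
by case: ifP => _; lia.
Qed.

(** * General moduli *)

(* Bounds (number of roots)^2 / n; a factor 2 is lost at each of the primes 2 and 3. *)
Definition sqrt_defect (n : nat) : nat := (2 ^ (2 %| n) * 2 ^ (3 %| n))%N.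

Lemma sqrt_defect_le4 (n : nat) : (sqrt_defect n <= 4)%N.
Proof. by rewrite /sqrt_defect; case: (2 %| n)%N; case: (3 %| n)%N. Qed.

Lemma sqrt_defectM_prime_power (p k m : nat) :
  prime p -> coprime p m -> (0 < k)%N ->
  sqrt_defect (m * p ^ k) = (sqrt_defect m * if p <= 3 then 2 else 1)%N.
Proof.
move=> pp; rewrite prime_coprime // => ndv k_gt0.
rewrite /sqrt_defect !Euclid_dvdM // !Euclid_dvdX // k_gt0 !andbT.
rewrite (dvdn_prime2 (_ : prime 2) pp) // (dvdn_prime2 (_ : prime 3) pp) //.
rewrite ![_ == p]eq_sym.
have [p2|p2] := eqVneq p 2%N.
  by rewrite p2 in ndv *; rewrite (negPf ndv) orbF mulnAC.
have [p3|p3] := eqVneq p 3%N.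
  by rewrite p3 in ndv *; rewrite (negPf ndv) orbF -mulnA.
rewrite ifF; last by have := prime_gt1 pp; lia.
by rewrite !orbF muln1.
Qed.

(** Strong induction, splitting off the full power of the smallest prime factor, so that the
    cofactor is coprime to it. *)
Lemma card_quad_roots_sqr (n : nat) (r b : int) : (0 < n)%N ->
  (#|quad_roots n r b| ^ 2 <= sqrt_defect n * n)%N.
Proof.
elim/ltn_ind: n => n IH n_gt0.
have [n_le1|n_gt1] := leqP n 1.
  have -> : n = 1%N by lia.
  by rewrite -[X in (_ <= X)%N](exp1n 2) leq_sqr -[X in (_ <= X)%N](card_ord 1) max_card.
pose p := pdiv n; have pp : prime p by apply: pdiv_prime.
have p_gt1 := prime_gt1 pp.
have [m co_pm nE] := pfactor_coprime pp n_gt0.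
have k_gt0 : (0 < logn p n)%N by rewrite logn_gt0 mem_primes pp n_gt0 pdiv_dvd.
move: (logn p n) nE k_gt0 => k nE k_gt0.
have pk_gt1 : (1 < p ^ k)%N by rewrite -(exp1n k) ltn_exp2r.
have m_gt0 : (0 < m)%N by move: n_gt0; rewrite nE muln_gt0 => /andP[].
have m_lt_n : (m < n)%N by rewrite nE ltn_Pmulr.
have co : coprime m (p ^ k) by rewrite coprime_sym coprimeXl.
rewrite nE sqrt_defectM_prime_power // mulnACA.
apply: leq_trans (leq_mul (IH m m_lt_n m_gt0) (card_quad_roots_prime_power k r b pp)).
by rewrite -expnMn leq_sqr card_quad_rootsM // ltnW.
Qed.

Lemma card_quad_roots_prime (p : nat) (r b : int) :
  prime p -> (#|quad_roots p r b| <= 2)%N.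
Proof. exact: (@card_quad_roots_odd_power p 0 r b). Qed.

(** * Agreements of the two mappings *)

Lemma card_bigcup_le (I T : finType) (F : I -> {set T}) (N : nat) :
  (forall i, #|F i| <= N)%N -> (#|\bigcup_i F i| <= #|I| * N)%N.
Proof.
move=> FN; rewrite -sum_nat_const.
apply: (@leq_trans (\sum_i #|F i|)); last by apply: leq_sum => i _; apply: FN.
elim/big_rec2: _ => [|i m A _ IH]; first by rewrite cards0.
by apply: leq_trans (leq_card_setU _ _) _; rewrite leq_add2l.
Qed.

Lemma card_diffie_hellman_agreement (gT : finGroupType) (G : {group gT}) (g : gT)
    (l : nat) (d f : gT -> gT) :
  generator G g -> (0 < l)%N -> (l %| #|G|)%N ->
  diffie_hellman_mapping G g d -> cyclotomic_mapping G g l f ->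
  exists r b, (#|[set x in G | f x == d x]| <= l * #|quad_roots #|G| r b|)%N.
Proof.
move=> /eqP Gg l_gt0 ln dP [r [a [_ aG fP]]].
have [b bP] : exists b : 'I_l -> nat, forall i, a i = (g ^+ b i)%g.
  have ex i : exists k, a i == (g ^+ k)%g.
    by have := aG i; rewrite Gg => /cycleP[k ->]; exists k.
  by exists (fun i => xchoose (ex i)) => i; apply/eqP/(xchooseP (ex i)).
pose roots (i : 'I_l) := quad_roots #|G| r%:Z (b i)%:Z.
pose i0 : 'I_l := Ordinal l_gt0.
(* The exponent [r] is common to all cosets and only [b i] varies; the coset whose congruence has
   the most roots bounds all the others. *)
have [m _ m_max] := @arg_maxnP _ i0 predT (fun i => #|roots i|) isT.
exists r%:Z, (b m)%:Z.
pose A (i : 'I_l) := [set (g ^+ (x : nat))%g | x : 'I_#|G| in roots i].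
apply: leq_trans (_ : (#|\bigcup_i A i| <= _)%N); last first.
  rewrite -[X in (X * _)%N](card_ord l); apply: card_bigcup_le => i.
  exact: leq_trans (leq_imset_card _ _) (m_max i isT).
apply/subset_leq_card/subsetP => x; rewrite inE => /andP[xG /eqP fd].
have [k kn xE] : exists2 k, (k < #|G|)%N & x = (g ^+ k)%g.
  move: xG; rewrite {1}Gg => /cyclePmin[k kn ->]; exists k => //.
  by rewrite Gg -orderE.
(* The coset containing [g ^+ k] is indexed by [k %% l]. *)
have ki : (k %% l < l)%N by rewrite ltn_mod.
pose i := Ordinal ki.
have kj : (k %/ l < #|G| %/ l)%N by rewrite ltn_divLR // divnK.
apply/bigcupP; exists i => //; apply/imsetP; exists (Ordinal kn) => //.
have xC : x \in cyclotomic_coset G g l i.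
  apply/lcosetP; exists (g ^+ (k %/ l * l))%g.
    by apply/imsetP; exists (Ordinal kj).
  by rewrite -expgD xE {1}(divn_eq k l) addnC.
(* Agreement at [g ^+ k] reads [b i + k * r = k ^ 2] modulo the order of [g]. *)
move: fd; rewrite (fP _ _ xC) xE dP // bP -expgM -expgD => /eqP.
rewrite eq_expg_mod_order orderE -Gg => e.
rewrite inE /=.
have -> : k%:Z ^+ 2 - r%:Z * k%:Z - (b i)%:Z = (k ^ 2)%N%:Z - (b i + k * r)%N%:Z by lia.
by rewrite -eqz_mod_dvd !modz_nat (eqP e).
Qed.

Theorem theorem2 (R : realType) :
  exists c : R, 0 < c /\
    forall (gT : finGroupType) (G : {group gT}) (g : gT) (n l : nat)
      (d f : gT -> gT),
      #|G| = n -> (2 <= n)%N -> generator G g ->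
      (0 < l)%N -> (l %| n)%N ->
      diffie_hellman_mapping G g d ->
      cyclotomic_mapping G g l f ->
      (#|[set x in G | f x == d x]|)%:R <= c * l%:R * Num.sqrt (n%:R : R) /\
      (prime n -> (#|[set x in G | f x == d x]| <= 2 * l)%N).
Proof.
(* The constant is the square root of 4, the largest value of [sqrt_defect]. *)
exists 2; split=> // gT G g n l d f <- n_ge2 Gg l_gt0 ln dP fP.
have [r [b agree_le]] := card_diffie_hellman_agreement Gg l_gt0 ln dP fP.
split=> [|n_prime]; last first.
  by rewrite mulnC (leq_trans agree_le) // leq_mul2l card_quad_roots_prime ?orbT.
apply: le_trans (_ : (l * #|quad_roots #|G| r b|)%:R <= _); first by rewrite ler_nat.
rewrite natrM -mulrA mulrCA ler_wpM2l //.
rewrite -(@ler_pXn2r _ 2) ?nnegrE ?mulr_ge0 ?sqrtr_ge0 //.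
rewrite exprMn sqr_sqrtr // -!natrX -natrM ler_nat.
apply: leq_trans (card_quad_roots_sqr r b (cardG_gt0 G)) _.
by rewrite leq_mul2r sqrt_defect_le4 orbT.
Qed.
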